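(* Let $\mathbf{R}$ be an associative algebra with unit over a field $k$. Let $R\in\mathbf{R}^{\otimes 2}$ be a solution of the Yang-Baxter equation $$R_{12}R_{13}R_{23}=R_{23}R_{13}R_{12}\quad\text{in }\mathbf{R}^{\otimes 3},$$ and let $F\in\mathbf{R}^{\otimes 2}$, $\Phi\in\mathbf{R}^{\otimes 3}$ and $\Psi\in\mathbf{R}^{\otimes 3}$ be invertible elements satisfying $$\Phi_{123}F_{12}=\Psi_{123}F_{23},\qquad R_{12}\Phi_{123}=\Phi_{213}R_{12},\qquad R_{23}\Psi_{123}=\Psi_{132}R_{23}.$$ Then the element $$\tilde R=\tau(F^{-1})\,R\,F\in\mathbf{R}^{\otimes 2}$$ is also a solution of the Yang-Baxter equation, i.e. $\tilde R_{12}\tilde R_{13}\tilde R_{23}=\tilde R_{23}\tilde R_{13}\tilde R_{12}$.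
   Context: Tensor products are over $k$, and $\mathbf{R}^{\otimes n}$ carries the usual (componentwise) algebra structure with unit. For $X=\sum a\otimes b\in\mathbf{R}^{\otimes 2}$ and distinct $i,j$, $X_{ij}$ denotes the element of $\mathbf{R}^{\otimes 3}$ with $a$ in the $i$-th tensor factor, $b$ in the $j$-th factor and the unit in the remaining factor. For $\Phi=\sum a\otimes b\otimes c\in\mathbf{R}^{\otimes 3}$, $\Phi_{ijl}$ denotes the element with $a$ in factor $i$, $b$ in factor $j$, $c$ in factor $l$; thus $\Phi_{123}=\Phi$, $\Phi_{213}=\sum b\otimes a\otimes c$ and $\Phi_{132}=\sum a\otimes c\otimes b$. The map $\tau:\mathbf{R}^{\otimes 2}\to\mathbf{R}^{\otimes 2}$, $\tau(a\otimes b)=b\otimes a$, is the permutation of the tensor components. *)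

(* Defs.v *)
From HB Require Import structures.
From mathcomp Require Import all_boot all_algebra.
From mathcomp Require Import boolp.
Set Implicit Arguments.
Unset Strict Implicit.
Unset Printing Implicit Defensive.
Import GRing.Theory.
Local Open Scope ring_scope.
Local Open Scope quotient_scope.

(* An associative unital k-algebra, as a ring with a central ring morphism    *)
(* from k; the action of k is c.x = scalars c * x. Unlike algType, this does  *)
(* not require 1 != 0 (algType extends nzRingType), so that the zero algebra  *)
(* is covered and tensor powers need not be shown to be nontrivial.           *)
HB.mixin Record hasScalars (k : pzRingType) A of GRing.PzRing A := {
  scalars : {rmorphism k -> A};
  scalarsC : forall (c : k) (x : A), scalars c * x = x * scalars c
}.

#[short(type="assocAlgType")]
HB.structure Definition AssocAlgebra (k : pzRingType) :=
  {A of GRing.PzRing A & hasScalars k A}.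

Definition algType_assoc (k : fieldType) (A : algType k) : Type := A.

Section AlgTypeAssoc.
Variables (k : fieldType) (A : algType k).

HB.instance Definition _ := GRing.NzRing.on (algType_assoc A).

Fact in_algC (c : k) (x : algType_assoc A) :
  (in_alg A c : algType_assoc A) * x = x * in_alg A c.
Proof. by rewrite /= mulr_algl mulr_algr. Qed.

HB.instance Definition _ := hasScalars.Build k (algType_assoc A) in_algC.

End AlgTypeAssoc.

Section TensorPower.
Variables (k : fieldType) (A : assocAlgType k) (n : nat).
Implicit Types (a b : {ffun 'I_n -> A}) (c d : k).

Definition upd a i (x : A) : {ffun 'I_n -> A} :=
  [ffun j => if j == i then x else a j].

Definition multilinear (V : lmodType k) (f : {ffun 'I_n -> A} -> V) : Prop :=
  forall a i,
    (forall x y, f (upd a i (x + y)) = f (upd a i x) + f (upd a i y)) /\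
    (forall c x, f (upd a i (scalars c * x)) = c *: f (upd a i x)).

(* [:: (c_1, a_1); ...; (c_r, a_r)] stands for the formal sum                 *)
(*   \sum_l c_l (a_l 0 (x) ... (x) a_l (n-1)).                                *)
Definition formal_sum : Type := seq (k * {ffun 'I_n -> A}).
HB.instance Definition _ := Choice.on formal_sum.
Implicit Types s t u : formal_sum.

Inductive tensor_eq : formal_sum -> formal_sum -> Prop :=
| teq_refl s : tensor_eq s s
| teq_sym s t : tensor_eq s t -> tensor_eq t s
| teq_trans s t u : tensor_eq s t -> tensor_eq t u -> tensor_eq s u
| teq_cat s s' t t' :
    tensor_eq s s' -> tensor_eq t t' -> tensor_eq (s ++ t) (s' ++ t')
| teq_catC s t : tensor_eq (s ++ t) (t ++ s)
| teq_coef0 a : tensor_eq [:: (0, a)] [::]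
| teq_coefD c d a : tensor_eq [:: (c + d, a)] [:: (c, a); (d, a)]
| teq_slotD c a i x y :
    tensor_eq [:: (c, upd a i (x + y))] [:: (c, upd a i x); (c, upd a i y)]
| teq_slotZ c d a i x :
    tensor_eq [:: (c, upd a i (scalars d * x))] [:: (c * d, upd a i x)].

Definition teq : rel formal_sum := fun s t => `[< tensor_eq s t >].

Fact teq_is_refl : reflexive teq.
Proof. by move=> s; apply/asboolP; exact: teq_refl. Qed.

Fact teq_is_sym : symmetric teq.
Proof.
by move=> s t; apply/idP/idP => /asboolP h; apply/asboolP; exact: teq_sym.
Qed.

Fact teq_is_trans : transitive teq.
Proof.
move=> t s u /asboolP h1 /asboolP h2; apply/asboolP; exact: teq_trans h1 h2.
Qed.

Canonical teq_equiv := EquivRel teq teq_is_refl teq_is_sym teq_is_trans.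

(* The n-th tensor power of A over k: the quotient of the formal sums by the  *)
(* congruence that makes the pure tensors multilinear.                        *)
Definition tpow : Type := {eq_quot teq_equiv}.
HB.instance Definition _ := Choice.on tpow.
HB.instance Definition _ := EqQuotient.on tpow.
Implicit Types X Y Z : tpow.

Lemma teqP s t : tensor_eq s t <-> s = t %[mod tpow].
Proof.
split=> [h|h]; first by apply/eqmodP/asboolP.
by move/eqmodP: h => /asboolP.
Qed.

Definition tzero : tpow := \pi_tpow [::].
Definition tadd X Y : tpow := \pi_tpow (repr X ++ repr Y).
Definition scale_sum c s : formal_sum := [seq (c * p.1, p.2) | p <- s].
Definition tscale c X : tpow := \pi_tpow (scale_sum c (repr X)).
Definition topp X : tpow := tscale (-1) X.

Lemma teq_scale c s t :
  tensor_eq s t -> tensor_eq (scale_sum c s) (scale_sum c t).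
Proof.
elim=> {s t} /=.
- by move=> s; exact: teq_refl.
- by move=> s t _ h; exact: teq_sym.
- by move=> s t u _ h1 _ h2; exact: teq_trans h1 h2.
- by move=> s s' t t' _ h1 _ h2; rewrite /scale_sum !map_cat; exact: teq_cat.
- by move=> s t; rewrite /scale_sum !map_cat; exact: teq_catC.
- by move=> a; rewrite mulr0; exact: teq_coef0.
- by move=> d e a; rewrite mulrDr; exact: teq_coefD.
- by move=> d a i x y; exact: teq_slotD.
- by move=> d e a i x; rewrite mulrA; exact: teq_slotZ.
Qed.

Lemma tadd_pi s t : tadd (\pi s) (\pi t) = \pi_tpow (s ++ t).
Proof. by apply/teqP/teq_cat; apply/teqP; rewrite reprK. Qed.

Lemma tscale_pi c s : tscale c (\pi s) = \pi_tpow (scale_sum c s).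
Proof. by apply/teqP/teq_scale; apply/teqP; rewrite reprK. Qed.

Fact taddA : associative tadd.
Proof.
by elim/quotW=> s; elim/quotW=> t; elim/quotW=> u; rewrite !tadd_pi catA.
Qed.

Fact taddC : commutative tadd.
Proof.
elim/quotW=> s; elim/quotW=> t; rewrite !tadd_pi; apply/teqP; exact: teq_catC.
Qed.

Fact tadd0 : left_id tzero tadd.
Proof. by elim/quotW=> s; rewrite tadd_pi. Qed.

Fact tscaleDl X : {morph tscale^~ X : c d / c + d >-> tadd c d}.
Proof.
move=> c d; elim/quotW: X => s; rewrite !tscale_pi tadd_pi; apply/teqP.
elim: s => [|[e a] s IHs] /=; first exact: teq_refl.
rewrite mulrDl.
apply: (teq_trans (teq_cat (teq_coefD (c * e) (d * e) a) IHs)) => /=.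
apply: (@teq_cat [:: _] [:: _] _ _ (teq_refl _)).
rewrite -[X in tensor_eq X]cat1s -[X in tensor_eq _ (_ ++ X)]cat1s !catA.
exact: (teq_cat (teq_catC [:: _] _) (teq_refl _)).
Qed.

Fact tscale0 X : tscale 0 X = tzero.
Proof.
elim/quotW: X => s; rewrite !tscale_pi; apply/teqP.
elim: s => [|[e a] s IHs] /=; first exact: teq_refl.
by rewrite mul0r; exact: (teq_cat (teq_coef0 a) IHs).
Qed.

Fact tscale1 : left_id 1 tscale.
Proof.
elim/quotW=> s; rewrite tscale_pi; congr (\pi _).
by elim: s => //= -[c a] s ->; rewrite mul1r.
Qed.

Fact taddN : left_inverse tzero topp tadd.
Proof.
by move=> X; rewrite -{2}[X]tscale1 -tscaleDl addNr tscale0.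
Qed.

HB.instance Definition _ := GRing.isZmodule.Build tpow taddA taddC tadd0 taddN.

Fact tscaleA c d X : tscale c (tscale d X) = tscale (c * d) X.
Proof.
elim/quotW: X => s; rewrite !tscale_pi; congr (\pi _).
by rewrite /scale_sum -map_comp; apply: eq_map => p /=; rewrite mulrA.
Qed.

Fact tscaleDr : right_distributive tscale +%R.
Proof.
move=> c; elim/quotW=> s; elim/quotW=> t.
by rewrite [X in tscale c X]tadd_pi !tscale_pi [RHS]tadd_pi /scale_sum map_cat.
Qed.

HB.instance Definition _ :=
  GRing.Zmodule_isLmodule.Build k tpow tscaleA tscale1 tscaleDr tscaleDl.

Definition pure a : tpow := \pi_tpow [:: (1, a)].

Lemma tadd_repr X Y : X + Y = \pi_tpow (repr X ++ repr Y).
Proof. by []. Qed.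

Lemma tscale_repr c X : c *: X = \pi_tpow (scale_sum c (repr X)).
Proof. by []. Qed.

Lemma pi_cons c a s : \pi_tpow ((c, a) :: s) = c *: pure a + \pi_tpow s.
Proof.
by rewrite [c *: _]tscale_pi /= mulr1 [RHS]tadd_pi.
Qed.

Lemma pi_sum s : \pi_tpow s = \sum_(p <- s) p.1 *: pure p.2.
Proof.
by elim: s => [|[c a] s IHs]; rewrite ?big_nil // big_cons pi_cons IHs.
Qed.

Lemma pure_multilinear : multilinear pure.
Proof.
move=> a i; split=> [x y|c x].
  by rewrite [RHS]tadd_pi; apply/teqP; exact: teq_slotD.
rewrite [RHS]tscale_pi /= mulr1; apply/teqP.
by have := teq_slotZ 1 c a i x; rewrite mul1r.
Qed.

Lemma tpow_ind (P : tpow -> Prop) :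
    P 0 -> (forall X Y, P X -> P Y -> P (X + Y)) ->
    (forall c a, P (c *: pure a)) ->
  forall X, P X.
Proof.
move=> P0 PD PZ; elim/quotW=> s; rewrite pi_sum.
by elim/big_ind: _ => // p _; exact: PZ.
Qed.

(* The linear extension of f. It is defined through chosen representatives;   *)
(* lift_pi shows that the choice does not matter if f is multilinear.         *)
Definition lift (V : lmodType k) (f : {ffun 'I_n -> A} -> V) (X : tpow) : V :=
  \sum_(p <- repr X) p.1 *: f p.2.

Section Lift.
Variables (V : lmodType k) (f : {ffun 'I_n -> A} -> V).
Hypothesis f_ml : multilinear f.

Lemma lift_pi s : lift f (\pi s) = \sum_(p <- s) p.1 *: f p.2.
Proof.
have: tensor_eq (repr (\pi_tpow s)) s by apply/teqP; rewrite reprK.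
rewrite /lift; move: (repr _) => r; elim=> {r s} //.
- by move=> s t u _ -> _ ->.
- by move=> s s' t t' _ h1 _ h2; rewrite !big_cat h1 h2.
- by move=> s t; rewrite !big_cat; exact: addrC.
- by move=> a; rewrite big_seq1 scale0r big_nil.
- by move=> c d a; rewrite !big_cons big_nil !addr0 scalerDl.
- move=> c a i x y; rewrite !big_cons big_nil !addr0 /=.
  by rewrite (f_ml a i).1 scalerDr.
- move=> c d a i x; rewrite !big_seq1 /=.
  by rewrite (f_ml a i).2 scalerA.
Qed.

Lemma lift_pure a : lift f (pure a) = f a.
Proof. by rewrite lift_pi big_seq1 scale1r. Qed.

Lemma liftD X Y : lift f (X + Y) = lift f X + lift f Y.
Proof.
by rewrite tadd_repr lift_pi big_cat.
Qed.

Lemma liftZ c X : lift f (c *: X) = c *: lift f X.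
Proof.
rewrite tscale_repr lift_pi big_map scaler_sumr.
by apply: eq_bigr => p _; rewrite scalerA.
Qed.

End Lift.

Definition fmul a b : {ffun 'I_n -> A} := [ffun i => a i * b i].
Definition fone : {ffun 'I_n -> A} := [ffun=> 1].

Definition tmul X Y : tpow :=
  lift (fun a => lift (fun b => pure (fmul a b)) Y) X.
Definition tone : tpow := pure fone.

Lemma fmul_updr a b i x : fmul a (upd b i x) = upd (fmul a b) i (a i * x).
Proof. by apply/ffunP=> j; rewrite !ffunE; case: eqP => [->|]. Qed.

Lemma fmul_updl a b i x : fmul (upd a i x) b = upd (fmul a b) i (x * b i).
Proof. by apply/ffunP=> j; rewrite !ffunE; case: eqP => [->|]. Qed.

Lemma fmul_ml a : multilinear (fun b => pure (fmul a b)).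
Proof.
move=> b i; split=> [x y|c x]; rewrite !fmul_updr.
  by rewrite mulrDr (pure_multilinear _ _).1.
by rewrite mulrA -scalarsC -mulrA (pure_multilinear _ _).2.
Qed.

Lemma tmul_ml Y : multilinear (fun a => lift (fun b => pure (fmul a b)) Y).
Proof.
move=> a i; split=> [x y|c x]; rewrite /lift.
  rewrite -big_split; apply: eq_bigr => p _ /=.
  by rewrite !fmul_updl mulrDl (pure_multilinear _ _).1 scalerDr.
rewrite scaler_sumr; apply: eq_bigr => p _.
by rewrite !fmul_updl -mulrA (pure_multilinear _ _).2 !scalerA mulrC.
Qed.

Lemma tmul_pure a b : tmul (pure a) (pure b) = pure (fmul a b).
Proof. by rewrite /tmul lift_pure ?lift_pure//; [exact: fmul_ml|exact: tmul_ml]. Qed.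

Lemma tmulE X Y :
  tmul X Y =
  \sum_(p <- repr X) p.1 *: lift (fun b => pure (fmul p.2 b)) Y.
Proof. by []. Qed.

Fact tmulDl : left_distributive tmul +%R.
Proof. by move=> X Y Z; rewrite /tmul liftD //; exact: tmul_ml. Qed.

Fact tmulDr : right_distributive tmul +%R.
Proof.
move=> X Y Z; rewrite !tmulE -big_split; apply: eq_bigr => p _ /=.
by rewrite -scalerDr; rewrite liftD //; exact: fmul_ml.
Qed.

Lemma tmulZl c X Y : tmul (c *: X) Y = c *: tmul X Y.
Proof. by rewrite /tmul liftZ //; exact: tmul_ml. Qed.

Lemma tmulZr c X Y : tmul X (c *: Y) = c *: tmul X Y.
Proof.
rewrite !tmulE scaler_sumr; apply: eq_bigr => p _.
rewrite scalerA mulrC -scalerA liftZ //; exact: fmul_ml.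
Qed.

Lemma tmul0l X : tmul 0 X = 0.
Proof. by have := tmulZl 0 0 X; rewrite !scale0r. Qed.

Lemma tmul0r X : tmul X 0 = 0.
Proof. by have := tmulZr 0 X 0; rewrite !scale0r. Qed.

Fact tmulA : associative tmul.
Proof.
move=> X Y Z.
elim/tpow_ind: X => [|X X' h h'|c a]; first by rewrite !tmul0l.
  by rewrite !tmulDl h h'.
rewrite !tmulZl; congr (_ *: _).
elim/tpow_ind: Y => [|Y Y' h h'|{}c b]; first by rewrite tmul0l !tmul0r tmul0l.
  by rewrite tmulDl !tmulDr tmulDl h h'.
rewrite !(tmulZl, tmulZr); congr (_ *: _).
elim/tpow_ind: Z => [|Z Z' h h'|{}c d]; first by rewrite !tmul0r.
  by rewrite !tmulDr h h'.
rewrite !tmulZr !tmul_pure; congr (_ *: pure _).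
by apply/ffunP=> i; rewrite !ffunE mulrA.
Qed.

Fact tmul1l : left_id tone tmul.
Proof.
elim/tpow_ind=> [|X X' h h'|c a]; rewrite ?tmul0r ?tmulDr ?h ?h' //.
rewrite tmulZr tmul_pure; congr (_ *: pure _).
by apply/ffunP=> i; rewrite !ffunE mul1r.
Qed.

Fact tmul1r : right_id tone tmul.
Proof.
elim/tpow_ind=> [|X X' h h'|c a]; rewrite ?tmul0l ?tmulDl ?h ?h' //.
rewrite tmulZl tmul_pure; congr (_ *: pure _).
by apply/ffunP=> i; rewrite !ffunE mulr1.
Qed.

HB.instance Definition _ :=
  GRing.Zmodule_isPzRing.Build tpow tmulA tmul1l tmul1r tmulDl tmulDr.

Definition tscalars c : tpow := c *: (1 : tpow).

Fact tscalars_zmod : zmod_morphism tscalars.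
Proof. by move=> c d; rewrite /tscalars scalerBl. Qed.

Fact tscalars_monoid : monoid_morphism tscalars.
Proof.
split=> [|c d]; rewrite /tscalars ?scale1r //.
have e : tmul (c *: tone) (d *: tone) = (c * d) *: tone.
  by rewrite tmulZl tmulZr tmul1l scalerA.
exact: esym e.
Qed.

HB.instance Definition _ := GRing.isZmodMorphism.Build k tpow tscalars tscalars_zmod.
HB.instance Definition _ := GRing.isMonoidMorphism.Build k tpow tscalars tscalars_monoid.

Fact tscalarsC c X : tscalars c * X = X * tscalars c.
Proof.
rewrite /tscalars [LHS]tmulZl [RHS]tmulZr; congr (_ *: _).
exact: etrans (tmul1l X) (esym (tmul1r X)).
Qed.

HB.instance Definition _ := hasScalars.Build k tpow tscalarsC.

Lemma pureM a b : pure a * pure b = pure [ffun i => a i * b i].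
Proof. exact: tmul_pure. Qed.

Lemma pure1 : pure [ffun=> 1] = 1.
Proof. by []. Qed.

End TensorPower.

Arguments tpow {k} A n.

Section Legs.
Variables (k : fieldType) (A : assocAlgType k) (m n : nat).
Implicit Types s : m.-tuple 'I_n.

Definition place s (a : {ffun 'I_m -> A}) : {ffun 'I_n -> A} :=
  [ffun j => if [pick i | tnth s i == j] is Some i then a i else 1].

(* The i-th tensor factor is put in position tnth s i, the unit in the        *)
(* remaining positions. Meaningful only if the positions are distinct.        *)
Definition legs s (X : tpow A m) : tpow A n := lift (fun a => pure (place s a)) X.

Lemma place_upd s a i x : uniq s -> place s (upd a i x) = upd (place s a) (tnth s i) x.
Proof.
move=> /tuple_uniqP s_inj; apply/ffunP=> j; rewrite !ffunE.
case: pickP => [i' /eqP <-|no_i]; first by rewrite ffunE (inj_eq s_inj).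
by have:= no_i i; rewrite eq_sym => ->.
Qed.

Lemma place_ml s : uniq s -> multilinear (fun a => pure (place s a)).
Proof.
move=> us a i; split=> [x y|c x]; rewrite !place_upd //.
  exact: (pure_multilinear _ _).1.
exact: (pure_multilinear _ _).2.
Qed.

Lemma legs_pure s a : uniq s -> legs s (pure a) = pure (place s a).
Proof. by move=> us; rewrite /legs lift_pure //; exact: place_ml. Qed.

Lemma legsD s X Y : uniq s -> legs s (X + Y) = legs s X + legs s Y.
Proof. by move=> us; exact: (liftD (place_ml us)). Qed.

Lemma legsZ s c X : uniq s -> legs s (c *: X) = c *: legs s X.
Proof. by move=> us; exact: (liftZ (place_ml us)). Qed.

End Legs.

Definition p1 : 'I_3 := @Ordinal 3 0 isT.
Definition p2 : 'I_3 := @Ordinal 3 1 isT.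
Definition p3 : 'I_3 := @Ordinal 3 2 isT.

Section ThreeFactors.
Variables (k : fieldType) (A : assocAlgType k).

Definition leg2 (X : tpow A 2) (i j : 'I_3) : tpow A 3 := legs [tuple i; j] X.
Definition leg3 (X : tpow A 3) (i j l : 'I_3) : tpow A 3 :=
  legs [tuple i; j; l] X.

Definition tau : tpow A 2 -> tpow A 2 := legs [tuple ord_max; ord0].

Definition tens2 (a b : A) : tpow A 2 := pure [ffun i => tnth [tuple a; b] i].
Definition tens3 (a b c : A) : tpow A 3 := pure [ffun i => tnth [tuple a; b; c] i].

Definition yang_baxter (X : tpow A 2) : Prop :=
  leg2 X p1 p2 * leg2 X p1 p3 * leg2 X p2 p3 =
  leg2 X p2 p3 * leg2 X p1 p3 * leg2 X p1 p2.

Let placeE m n (s : m.-tuple 'I_n) (a : {ffun 'I_m -> A}) i :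
  uniq s -> place s a (tnth s i) = a i.
Proof.
move=> /tuple_uniqP s_inj; rewrite ffunE; case: pickP => [j /eqP/s_inj-> //|].
by move/(_ i); rewrite eqxx.
Qed.

Let placeN m n (s : m.-tuple 'I_n) (a : {ffun 'I_m -> A}) j :
  j \notin s -> place s a j = 1.
Proof.
move=> js; rewrite ffunE; case: pickP => // i /eqP sj.
by move: js; rewrite -sj mem_tnth.
Qed.

Let ord3P (P : 'I_3 -> Prop) : P p1 -> P p2 -> P p3 -> forall i, P i.
Proof.
move=> h1 h2 h3 [[|[|[|//]]] hi].
- by rewrite (_ : Ordinal hi = p1) //; exact: val_inj.
- by rewrite (_ : Ordinal hi = p2) //; exact: val_inj.
- by rewrite (_ : Ordinal hi = p3) //; exact: val_inj.
Qed.

Lemma tau_tens2 a b : tau (tens2 a b) = tens2 b a.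
Proof.
rewrite /tau legs_pure //; congr pure; apply/ffunP=> -[[|[|//]] hi].
- rewrite (_ : Ordinal hi = tnth [tuple ord_max; ord0] (ord_max : 'I_2)).
    by rewrite placeE // !ffunE.
  exact: val_inj.
- rewrite (_ : Ordinal hi = tnth [tuple ord_max; ord0] (ord0 : 'I_2)).
    by rewrite placeE // !ffunE.
  exact: val_inj.
Qed.

Lemma leg2_tens a b :
  [/\ leg2 (tens2 a b) p1 p2 = tens3 a b 1,
      leg2 (tens2 a b) p1 p3 = tens3 a 1 b &
      leg2 (tens2 a b) p2 p3 = tens3 1 a b].
Proof.
split; rewrite /leg2 legs_pure //; congr pure; apply/ffunP; apply: ord3P.
- by rewrite (placeE (s := [tuple p1; p2]) _ ord0) // !ffunE.
- by rewrite (placeE (s := [tuple p1; p2]) _ ord_max) // !ffunE.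
- by rewrite placeN // !ffunE.
- by rewrite (placeE (s := [tuple p1; p3]) _ ord0) // !ffunE.
- by rewrite placeN // !ffunE.
- by rewrite (placeE (s := [tuple p1; p3]) _ ord_max) // !ffunE.
- by rewrite placeN // !ffunE.
- by rewrite (placeE (s := [tuple p2; p3]) _ ord0) // !ffunE.
- by rewrite (placeE (s := [tuple p2; p3]) _ ord_max) // !ffunE.
Qed.

Lemma leg3_tens a b c :
  [/\ leg3 (tens3 a b c) p1 p2 p3 = tens3 a b c,
      leg3 (tens3 a b c) p2 p1 p3 = tens3 b a c &
      leg3 (tens3 a b c) p1 p3 p2 = tens3 a c b].
Proof.
split; rewrite /leg3 legs_pure //; congr pure; apply/ffunP; apply: ord3P.
- by rewrite (placeE (s := [tuple p1; p2; p3]) _ p1) // !ffunE.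
- by rewrite (placeE (s := [tuple p1; p2; p3]) _ p2) // !ffunE.
- by rewrite (placeE (s := [tuple p1; p2; p3]) _ p3) // !ffunE.
- by rewrite (placeE (s := [tuple p2; p1; p3]) _ p2) // !ffunE.
- by rewrite (placeE (s := [tuple p2; p1; p3]) _ p1) // !ffunE.
- by rewrite (placeE (s := [tuple p2; p1; p3]) _ p3) // !ffunE.
- by rewrite (placeE (s := [tuple p1; p3; p2]) _ p1) // !ffunE.
- by rewrite (placeE (s := [tuple p1; p3; p2]) _ p3) // !ffunE.
- by rewrite (placeE (s := [tuple p1; p3; p2]) _ p2) // !ffunE.
Qed.

End ThreeFactors.

Definition is_inverse (T : pzRingType) (x y : T) : Prop := x * y = 1 /\ y * x = 1.
Definition invertible (T : pzRingType) (x : T) : Prop :=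
  exists y, is_inverse x y.

(* Main.v *)
Require Import Defs.
From mathcomp Require Import all_boot all_algebra.
Set Implicit Arguments.
Unset Strict Implicit.
Unset Printing Implicit Defensive.
Import GRing.Theory.
Local Open Scope ring_scope.

(** Put [T = Phi_123 F_12 = Psi_123 F_23] and let [R~ = tau(F^-1) R F]. The two
    commutation hypotheses say that [T] intertwines [R~] with [R]:
    [T_jil R~_ij = R_ij T_ijl] and [T_ilj R~_jl = R_jl T_ijl] for every
    permutation [ijl] of [123]. Moving [T] through three factors gives
    [T_321 R~_12 R~_13 R~_23 = R_12 R_13 R_23 T_123] and
    [T_321 R~_23 R~_13 R~_12 = R_23 R_13 R_12 T_123], and [T_321] is invertible. *)

Section LegsMorphism.
Variables (k : fieldType) (A : assocAlgType k).

Lemma place_mul m n (s : m.-tuple 'I_n) (a b : {ffun 'I_m -> A}) :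
  place s (fmul a b) = fmul (place s a) (place s b).
Proof.
by apply/ffunP=> j; rewrite !ffunE; case: pickP => [i _|_]; rewrite ?ffunE ?mulr1.
Qed.

(** Injectivity of [t] makes the preimage of a slot unique; a slot outside the image of [t] receives
    the unit on both sides. *)
Lemma place_comp m n q (s : m.-tuple 'I_n) (t : n.-tuple 'I_q)
    (a : {ffun 'I_m -> A}) :
  uniq t -> place t (place s a) = place (map_tuple (tnth t) s) a.
Proof.
move=> /tuple_uniqP t_inj; apply/ffunP=> j; rewrite [LHS]ffunE [RHS]ffunE.
case: (pickP (fun i => tnth t i == j)) => [i /eqP <-|no_i].
  rewrite ffunE; congr (if _ is Some i' then a i' else 1).
  by apply: eq_pick => x; rewrite tnth_map (inj_eq t_inj).
by case: pickP => // x; rewrite tnth_map no_i.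
Qed.

Lemma legs0 m n (s : m.-tuple 'I_n) : uniq s -> legs s (0 : tpow A m) = 0.
Proof. by move=> us; have := legsZ 0 (0 : tpow A m) us; rewrite !scale0r. Qed.

Lemma legs1 m n (s : m.-tuple 'I_n) : uniq s -> legs s (1 : tpow A m) = 1.
Proof.
move=> us; rewrite -!pure1 legs_pure //; congr pure.
by apply/ffunP=> j; rewrite !ffunE; case: pickP => // i _; rewrite ffunE.
Qed.

(** Both sides are bilinear in [X] and [Y], which reduces the claim to pure tensors; there it holds
    slot by slot, with [1 * 1 = 1] in the unfilled slots. *)
Lemma legsM m n (s : m.-tuple 'I_n) (X Y : tpow A m) :
  uniq s -> legs s (X * Y) = legs s X * legs s Y.
Proof.
move=> us.
elim/tpow_ind: X => [|X X' hX hX'|c a].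
- by rewrite legs0 // !mul0r legs0.
- by rewrite mulrDl !legsD // mulrDl hX hX'.
(* The ring product of [tpow] is [tmul] by definition, so [tmulZl] and [tmulZr] apply up to
   conversion. *)
have -> : c *: pure a * Y = c *: (pure a * Y) by exact: tmulZl.
rewrite !legsZ //.
have -> Z : c *: legs s (pure a) * Z = c *: (legs s (pure a) * Z).
  exact: tmulZl.
congr (_ *: _).
elim/tpow_ind: Y => [|Y Y' hY hY'|d b].
- by rewrite legs0 // !mulr0 legs0.
- by rewrite mulrDr !legsD // mulrDr hY hY'.
have -> : pure a * (d *: pure b) = d *: (pure a * pure b) by exact: tmulZr.
rewrite !legsZ //.
have -> Z : Z * (d *: legs s (pure b)) = d *: (Z * legs s (pure b)).
  exact: tmulZr.
congr (_ *: _).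
by rewrite !legs_pure // !pureM legs_pure // place_mul.
Qed.

Lemma legs_comp m n q (s : m.-tuple 'I_n) (t : n.-tuple 'I_q) (X : tpow A m) :
  uniq s -> uniq t -> legs t (legs s X) = legs (map_tuple (tnth t) s) X.
Proof.
move=> us ut.
have ust : uniq (map_tuple (tnth t) s).
  by rewrite map_inj_uniq //; exact/tuple_uniqP.
elim/tpow_ind: X => [|X Y hX hY|c a]; first by rewrite !legs0.
  by rewrite !legsD // hX hY.
by rewrite !legsZ // !legs_pure // place_comp.
Qed.

End LegsMorphism.

Section Legs3.
Variables (k : fieldType) (A : assocAlgType k).
Implicit Types (X Y : tpow A 2) (Z W : tpow A 3) (i j l : 'I_3).

Lemma leg2M X Y i j : i != j -> leg2 (X * Y) i j = leg2 X i j * leg2 Y i j.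
Proof. by move=> ij; apply: legsM; rewrite /= inE ij. Qed.

Lemma leg2_1 i j : i != j -> leg2 (1 : tpow A 2) i j = 1.
Proof. by move=> ij; apply: legs1; rewrite /= inE ij. Qed.

Lemma leg2_tau X i j : i != j -> leg2 (tau X) i j = leg2 X j i.
Proof.
move=> ij; rewrite /leg2 /tau legs_comp //=; last by rewrite inE ij.
by congr legs; apply: val_inj.
Qed.

Lemma leg3M Z W i j l : uniq [:: i; j; l] ->
  leg3 (Z * W) i j l = leg3 Z i j l * leg3 W i j l.
Proof. by move=> u; apply: legsM. Qed.

Lemma leg3_1 i j l : uniq [:: i; j; l] -> leg3 (1 : tpow A 3) i j l = 1.
Proof. by move=> u; apply: legs1. Qed.

(** Relabelling the factors by a permutation: for concrete [a] and [b] the [tnth] compute, so that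
    [X_12] becomes [X_ij] and [X_23] becomes [X_jl]. *)
Lemma leg3_leg2 X a b i j l : a != b -> uniq [:: i; j; l] ->
  leg3 (leg2 X a b) i j l =
  leg2 X (tnth [tuple i; j; l] a) (tnth [tuple i; j; l] b).
Proof.
move=> ab u; rewrite /leg3 /leg2 legs_comp //=; last by rewrite inE ab.
by congr legs; apply: val_inj.
Qed.

Lemma leg3_leg3 Z a b c i j l : uniq [:: a; b; c] -> uniq [:: i; j; l] ->
  leg3 (leg3 Z a b c) i j l =
  leg3 Z (tnth [tuple i; j; l] a) (tnth [tuple i; j; l] b)
    (tnth [tuple i; j; l] c).
Proof.
by move=> u v; rewrite /leg3 legs_comp //; congr legs; apply: val_inj.
Qed.

End Legs3.

Section Twist.
Variables (k : fieldType) (A : assocAlgType k).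
Variables (R F Finv : tpow A 2).
Hypothesis FK : F * Finv = 1.
Let Rt := tau Finv * R * F.

(** The leg [ij] of [tau Finv] is the leg [ji] of [Finv], which cancels against [F_ji]. *)
Lemma twist_leg2 i j : i != j -> leg2 F j i * leg2 Rt i j = leg2 R i j * leg2 F i j.
Proof.
move=> ij; rewrite /Rt !leg2M // leg2_tau // !mulrA -leg2M 1?eq_sym //.
by rewrite FK leg2_1 1?eq_sym // mul1r.
Qed.

(** First [twist_leg2] carries [Rt_ij] past [F], turning it into [R_ij]; then the relabelled
    hypothesis carries [R_ij] past [Phi]. *)
Lemma intertwine_12 (Phi : tpow A 3) i j l :
    leg2 R p1 p2 * leg3 Phi p1 p2 p3 = leg3 Phi p2 p1 p3 * leg2 R p1 p2 ->
    uniq [:: i; j; l] ->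
  let T := leg3 Phi p1 p2 p3 * leg2 F p1 p2 in
  leg3 T j i l * leg2 Rt i j = leg2 R i j * leg3 T i j l.
Proof.
(* Permuting the factors is a ring morphism, so the hypothesis on [Phi] gives
   [R_ij Phi_ijl = Phi_jil R_ij]. *)
move=> /(congr1 (fun Z => leg3 Z i j l)) + u /=.
have [ij jil] : i != j /\ uniq [:: j; i; l].
  move: u; rewrite /= !inE !negb_or !andbT => /andP[/andP[ij il] jl].
  by rewrite ij il jl [j == i]eq_sym ij.
rewrite !leg3M // !leg3_leg2 // !leg3_leg3 //= => RPhi.
by rewrite -mulrA [X in _ * X]twist_leg2 // !mulrA [in RHS]RPhi.
Qed.

(** Counterpart of [intertwine_12] for a swap of the last two indices. *)
Lemma intertwine_23 (Psi : tpow A 3) i j l :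
    leg2 R p2 p3 * leg3 Psi p1 p2 p3 = leg3 Psi p1 p3 p2 * leg2 R p2 p3 ->
    uniq [:: i; j; l] ->
  let T := leg3 Psi p1 p2 p3 * leg2 F p2 p3 in
  leg3 T i l j * leg2 Rt j l = leg2 R j l * leg3 T i j l.
Proof.
move=> /(congr1 (fun Z => leg3 Z i j l)) + u /=.
have [jl ilj] : j != l /\ uniq [:: i; l; j].
  move: u; rewrite /= !inE !negb_or !andbT => /andP[/andP[ij il] jl].
  by rewrite jl ij il [l == j]eq_sym jl.
rewrite !leg3M // !leg3_leg2 // !leg3_leg3 //= => RPsi.
by rewrite -mulrA [X in _ * X]twist_leg2 // !mulrA [in RHS]RPsi.
Qed.

End Twist.

Theorem theorem1 (k : fieldType) (A : assocAlgType k)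
    (R : tpow A 2) (F Finv : tpow A 2) (Phi Psi : tpow A 3) :
  yang_baxter R ->
  is_inverse F Finv ->
  invertible Phi ->
  invertible Psi ->
  leg3 Phi p1 p2 p3 * leg2 F p1 p2 = leg3 Psi p1 p2 p3 * leg2 F p2 p3 ->
  leg2 R p1 p2 * leg3 Phi p1 p2 p3 = leg3 Phi p2 p1 p3 * leg2 R p1 p2 ->
  leg2 R p2 p3 * leg3 Psi p1 p2 p3 = leg3 Psi p1 p3 p2 * leg2 R p2 p3 ->
  yang_baxter (tau Finv * R * F).
Proof.
move=> YB [FK KF] [Phi' [_ PhiK]] _ eqT RPhi RPsi.
have T12 i j l := @intertwine_12 _ _ R F Finv FK Phi i j l RPhi.
have T23 i j l := @intertwine_23 _ _ R F Finv FK Psi i j l RPsi.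
(* A left inverse of [T], later relabelled by [321] to cancel [T_321]. *)
have TK : leg2 Finv p1 p2 * leg3 Phi' p1 p2 p3 *
          (leg3 Phi p1 p2 p3 * leg2 F p1 p2) = 1.
  rewrite mulrA -[_ * _ * leg3 Phi _ _ _]mulrA -leg3M // PhiK leg3_1 // mulr1.
  by rewrite -leg2M // KF leg2_1.
(* From here both intertwining rules concern the same [T]. *)
rewrite -eqT in T23; move: T12 T23 TK => /=.
set T := _ * leg2 F p1 p2; set Rt := tau _ * _ * _; set T' := _ * _.
move=> T12 T23 /(congr1 (fun Z => leg3 Z p3 p2 p1)).
rewrite leg3M // leg3_1 // => TK.
(* Inserting [1 = T'_321 T_321] on both sides and removing [T'_321] leaves both sides multiplied on
   the left by [T_321]. *)
rewrite /yang_baxter -[LHS]mul1r -[RHS]mul1r -TK -!mulrA; congr (_ * _).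
(* On the left, [T] runs through [T_321], [T_312], [T_132], [T_123]. *)
rewrite !mulrA T23 // -2![LHS]mulrA [X in _ * X]mulrA T12 // -mulrA T23 //.
(* On the right, [T] runs through [T_321], [T_231], [T_213], [T_123]. *)
rewrite T12 // -2![RHS]mulrA [X in _ = _ * X]mulrA T23 // -[X in _ = _ * X]mulrA.
by rewrite T12 // !mulrA YB.
Qed.
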